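(* Let $n>1$ and $d\ge 1$ be integers, and suppose that $n$ is odd or $d$ is even. Then all eigenvalues (of the adjacency matrix) of the unitary finite-Euclidean graph $T_n^{(d)}$ are integers.
   Context: $\mathbb{Z}_n$ denotes the ring of integers modulo $n$ and $\mathbb{Z}_n^{*}$ its group of units. The unitary finite-Euclidean graph $T_n^{(d)}$ is the undirected graph with vertex set $\mathbb{Z}_n^d$ in which two vertices $a=(a_1,\dots,a_d)$ and $b=(b_1,\dots,b_d)$ are adjacent if and only if $\sum_{i=1}^d (a_i-b_i)^2\in\mathbb{Z}_n^{*}$. Equivalently, it is the Cayley graph of the additive group $\mathbb{Z}_n^d$ with connection set $S_d(n)=\{x\in\mathbb{Z}_n^d : \sum_{i=1}^d x_i^2\in\mathbb{Z}_n^{*}\}$. *)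

(* Defs.v *)
From HB Require Import structures.
From mathcomp Require Import all_boot all_order all_algebra.

Set Implicit Arguments.
Unset Strict Implicit.
Unset Printing Implicit Defensive.

Import GRing.Theory Num.Theory.
Local Open Scope ring_scope.

Definition adjacency_mx (R : nzRingType) (T : finType) (e : rel T) :
    'M[R]_#|T| :=
  \matrix_(i, j) (e (enum_val i) (enum_val j))%:R.

(* 'Z_n is the ring of integers modulo n only for 1 < n ('Z_0 and 'Z_1 are
   Z/2), so unitary_euclidean is meaningful only under that hypothesis. *)
Definition unitary_euclidean (n d : nat) : rel 'rV['Z_n]_d :=
  fun a b => \sum_(i < d) (a 0 i - b 0 i) ^+ 2 \is a GRing.unit.

Lemma unitary_euclidean_sym n d : symmetric (@unitary_euclidean n d).
Proof.
move=> a b; rewrite /unitary_euclidean; congr (_ \is a GRing.unit).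
by apply: eq_bigr => i _; rewrite -sqrrN opprB.
Qed.

Lemma unitary_euclidean_irr n d : irreflexive (@unitary_euclidean n d).
Proof.
move=> a; rewrite /unitary_euclidean big1 ?unitr0 // => i _.
by rewrite subrr expr0n.
Qed.

(* Main.v *)
Require Import Defs.
From mathcomp Require Import all_boot all_order all_algebra.
From mathcomp Require Import fingroup action cyclic separable cyclotomic.

Set Implicit Arguments.
Unset Strict Implicit.
Unset Printing Implicit Defensive.

Import GRing.Theory Num.Theory.
Local Open Scope ring_scope.

(** The graph is a Cayley graph of the finite abelian group (Z/n)^d, with
connection set S, the vectors x whose q(x) = x_1^2 + ... + x_d^2 is a unit.
Characters diagonalize such a graph: with z a primitive n-th root of unity,
every eigenvalue has the form

    lambda_b = sum_(x in S) z^(b . x)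

for some vector b ([cayley_eigenvalue]).

The units of Z/n act on S by scaling, because q(u x) = u^2 q(x). The action is
free: if u x = v x then u q(x) = v q(x), and q(x) can be cancelled. Summing
over one orbit at a time therefore writes lambda_b as a sum of terms
sum_(u unit) z^(u (b . x)), which are Ramanujan sums. A Ramanujan sum is an
integer ([ramanujan_sum_integer]): sorting the full geometric sum of the powers
of an n-th root of unity by the gcd of the exponent with n expresses it through
Ramanujan sums of smaller moduli. Hence lambda_b is a sum of integers
([sum_free_unit_stable_integer]). *)

Definition is_integer (R : pzRingType) (x : R) := exists m : int, x = m%:~R.

Lemma is_integer_nat (R : pzRingType) k : is_integer (k%:R : R).
Proof. by exists k%:Z. Qed.

Lemma is_integerB (R : pzRingType) (x y : R) :
  is_integer x -> is_integer y -> is_integer (x - y).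
Proof. by case=> [m ->] [k ->]; exists (m - k); rewrite rmorphB. Qed.

Lemma is_integer_sum (R : pzRingType) (I : Type) (r : seq I) (P : pred I)
    (F : I -> R) :
  (forall i, P i -> is_integer (F i)) -> is_integer (\sum_(i <- r | P i) F i).
Proof.
move=> FZ; elim/big_rec: _ => [|i x Pi [k ->]]; first by exists 0.
by case: (FZ i Pi) => m ->; exists (m + k); rewrite rmorphD.
Qed.

Lemma sum_expr_unity_root (R : idomainType) n (z : R) :
  z ^+ n = 1 -> \sum_(k < n) z ^+ k = if z == 1 then n%:R else 0.
Proof.
move=> zn1; have [->|z_neq1] := eqVneq.
  rewrite (eq_bigr (fun=> 1)) => [|i _]; last by rewrite expr1n.
  by rewrite sumr_const card_ord.
have /eqP := subrX1 z n; rewrite zn1 subrr eq_sym mulf_eq0 subr_eq0.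
by rewrite (negPf z_neq1) => /eqP.
Qed.

(** The exponents below m * d whose gcd with m * d is d are the multiples j * d
with j coprime to m, so this part of a power sum is a Ramanujan-type sum for
the modulus m at the root z ^+ d. *)
Lemma sum_expr_gcd (R : pzSemiRingType) d m (z : R) : (0 < d)%N ->
  \sum_(k < m * d | gcdn k (m * d) == d) z ^+ k
    = \sum_(j < m | coprime j m) (z ^+ d) ^+ j.
Proof.
move=> d_gt0.
have mul_lt (j : 'I_m) : (j * d < m * d)%N by rewrite ltn_pmul2r.
have div_lt (k : 'I_(m * d)) : (k %/ d < m)%N by rewrite ltn_divLR.
rewrite (reindex_onto (fun j => Ordinal (mul_lt j))
                      (fun k => Ordinal (div_lt k))) /=; last first.
  move=> k /eqP gcd_d; apply: val_inj; rewrite /= divnK //.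
  by have := dvdn_gcdl k (m * d); rewrite gcd_d.
apply: eq_big => [j | j _]; last by rewrite -exprM mulnC.
rewrite -muln_gcdl -{2}[d]mul1n eqn_pmul2r //.
by rewrite [X in _ && X](_ : _ = true) ?andbT //; apply/eqP/val_inj;
  rewrite /= mulnK.
Qed.

(** Strong induction on n. The sum of all powers of z is 0 or n; its part with
exponents of gcd d with n is, by [sum_expr_gcd], a sum of the same shape for
the modulus n / d and the root z ^+ d. The part d = 1 is the sum in question,
and all the others have a smaller modulus. *)
Lemma ramanujan_sum_integer (R : idomainType) n (z : R) :
  (0 < n)%N -> z ^+ n = 1 -> is_integer (\sum_(k < n | coprime k n) z ^+ k).
Proof.
have [N] := ubnP n; elim: N => // N IHN in n z * => /ltnSE le_n_N n_gt0 zn1.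
have gcd_lt (k : 'I_n) : (gcdn k n < n.+1)%N.
  by rewrite ltnS dvdn_leq ?dvdn_gcdr.
have := sum_expr_unity_root zn1.
rewrite (partition_big (fun k => Ordinal (gcd_lt k))
  (fun d : 'I_n.+1 => d %| n)%N);
  last by move=> k _; rewrite /= dvdn_gcdr.
have lt1n : (1 < n.+1)%N by rewrite ltnS.
rewrite (bigD1 (Ordinal lt1n)) ?dvd1n //= => sumE.
(* Isolate the part d = 1, which is the sum over exponents coprime to n. *)
rewrite (_ : \sum_(k < n | _) _ = (if z == 1 then n%:R else 0) -
  \sum_(d < n.+1 | (d %| n)%N && (d != Ordinal lt1n))
    \sum_(k < n | gcdn k n == d) z ^+ k); last first.
  by rewrite -sumE -addrA subrr addr0.
apply: is_integerB.
  by case: ifP => _; [exact: is_integer_nat | exists 0].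
apply: is_integer_sum => -[d /= d_le] /andP[/dvdnP[m def_n]].
rewrite -val_eqE /= => d_neq1.
move: n_gt0; rewrite def_n muln_gt0 => /andP[m_gt0 d_gt0].
rewrite sum_expr_gcd //; apply: IHN => //; last by rewrite -exprM mulnC -def_n.
rewrite (leq_trans _ le_n_N) // def_n ltn_Pmulr //.
by rewrite ltn_neqAle eq_sym d_neq1.
Qed.

(** As n is invertible, 'X^n - 1 is separable, so it has n distinct roots; in a
field, n distinct n-th roots of unity always include a primitive one. *)
Lemma closed_field_prim_root (F : closedFieldType) n :
  (n%:R != 0 :> F) -> exists z : F, n.-primitive_root z.
Proof.
move=> nF0; have n_gt0 : (0 < n)%N by case: n nF0 => //; rewrite eqxx.
have [rs def_p] := closed_field_poly_normal ('X^n - 1 : {poly F}).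
move: def_p; rewrite lead_coefXnsubC // scale1r => def_p.
have rs_uniq : uniq rs.
  by rewrite -separable_prod_XsubC -def_p separable_Xn_sub_1.
have /hasP[z _ z_prim] : has n.-primitive_root rs; last by exists z.
apply: has_prim_root => //.
  by apply/allP=> z z_rs; rewrite /root_of_unity def_p root_prod_XsubC.
rewrite -ltnS -(size_prod_XsubC rs id) -def_p size_XnsubC //.
Qed.

Section Characters.

Variables (n : nat) (n_gt1 : (1 < n)%N).

Section UnityRoot.

Variables (R : idomainType) (z : R) (zn1 : z ^+ n = 1).

(** For z an n-th root of unity, t |-> z ^+ t is well defined on residues: the
next three lemmas let the modular operations of 'Z_n be read in exponents. *)
Lemma expr_modZp k : z ^+ (k %% (Zp_trunc n).+2) = z ^+ k.
Proof. by rewrite Zp_cast // expr_mod. Qed.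

Lemma expr_ZpD (s t : 'Z_n) : z ^+ (s + t)%R = z ^+ s * z ^+ t.
Proof. by rewrite expr_modZp exprD. Qed.

Lemma expr_ZpM (s t : 'Z_n) : z ^+ (s * t)%R = (z ^+ t) ^+ s.
Proof. by rewrite expr_modZp mulnC exprM. Qed.

Lemma sum_units_integer (t : 'Z_n) :
  is_integer (\sum_(u : {unit 'Z_n}) z ^+ (val u * t)%R).
Proof.
rewrite (eq_bigr (fun u : {unit 'Z_n} => (z ^+ t) ^+ val u)); last first.
  by move=> u _; rewrite expr_ZpM.
have wn1 : (z ^+ t) ^+ n = 1 by rewrite exprAC zn1 expr1n.
move: (z ^+ t) wn1 => w wn1.
suff -> : \sum_(u : {unit 'Z_n}) w ^+ val u = \sum_(k < n | coprime k n) w ^+ k.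
  by apply: ramanujan_sum_integer; first exact: ltnW.
transitivity (\sum_(x : 'Z_n | x \is a GRing.unit) w ^+ x).
  rewrite (reindex_onto val (insubd (1%g : {unit 'Z_n}))) => [|x x_unit].
    by apply: eq_bigl => u; rewrite valKd eqxx (valP u).
  by rewrite insubdK.
transitivity (\sum_(k < (Zp_trunc n).+2 | coprime k n) w ^+ k).
  by apply: eq_bigl => x; rewrite -[x in LHS]natr_Zp unitZpE // coprime_sym.
by rewrite -(big_mkord (fun k => coprime k n) (fun k => w ^+ k))
  Zp_cast // big_mkord.
Qed.

End UnityRoot.

Definition dot d (b x : 'rV['Z_n]_d) : 'Z_n := \sum_i b 0 i * x 0 i.

Lemma dotC d (b x : 'rV['Z_n]_d) : dot b x = dot x b.
Proof. by apply: eq_bigr => i _; rewrite mulrC. Qed.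

Lemma dotDr d (b x y : 'rV['Z_n]_d) : dot b (x + y) = dot b x + dot b y.
Proof. by rewrite -big_split; apply: eq_bigr => i _; rewrite mxE mulrDr. Qed.

Lemma dotZr d u (b x : 'rV['Z_n]_d) : dot b (u *: x) = u * dot b x.
Proof. by rewrite mulr_sumr; apply: eq_bigr => i _; rewrite mxE mulrCA. Qed.

Lemma dot_delta d i (b : 'rV['Z_n]_d) : dot b (delta_mx 0 i) = b 0 i.
Proof.
rewrite /dot (bigD1 i) //= mxE !eqxx mulr1 big1 ?addr0 // => j ne_ji.
by rewrite mxE (negPf ne_ji) mulr0.
Qed.

(** Stability makes S a union of orbits of the unit group. Freeness makes each
orbit a bijective copy of that group, so that the orbit of x contributes exactly
one Ramanujan sum, at the residue b . x; otherwise it would contribute only a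
fraction of one. *)
Lemma sum_free_unit_stable_integer (R : idomainType) (z : R) d
    (b : 'rV['Z_n]_d) (S : {set 'rV['Z_n]_d}) :
    z ^+ n = 1 ->
    {in S, forall x u, u \is a GRing.unit -> u *: x \in S} ->
    {in S, forall x, injective (fun u => u *: x)} ->
  is_integer (\sum_(x in S) z ^+ dot b x).
Proof.
move=> zn1 S_stable S_free.
have act1 : (fun (x : 'rV['Z_n]_d) (u : {unit 'Z_n}) => val u *: x)^~ 1%g =1 id.
  by move=> x; rewrite /= scale1r.
have actM (x : 'rV['Z_n]_d) :
    act_morph (fun y (u : {unit 'Z_n}) => val u *: y) x.
  by move=> u v; rewrite /= scalerA mulrC.
pose to := TotalAction act1 actM.
have actsS : [acts [set: {unit 'Z_n}], on S | to].
  apply/actsP => u _ x; apply/idP/idP => [|Sx]; last exact: S_stable (valP u).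
  move=> /S_stable/(_ (val u)^-1); rewrite unitrV (valP u) => /(_ isT).
  by rewrite /= scalerA mulVr ?scale1r // (valP u).
rewrite (set_partition_big _ (orbit_partition actsS)) /=.
apply: is_integer_sum => _ /imsetP[x Sx ->].
rewrite big_imset => [|u v _ _ /(S_free x Sx)]; last exact: val_inj.
rewrite (eq_bigl xpredT) => [|u]; last by rewrite inE.
rewrite (eq_bigr (fun u => z ^+ (val u * dot b x)%R)); last first.
  by move=> u _; rewrite /= dotZr.
exact: sum_units_integer.
Qed.

Section Fourier.

Variables (F : numFieldType) (z : F) (z_prim : n.-primitive_root z) (d : nat).
Implicit Types b x y w : 'rV['Z_n]_d.

Let zn1 : z ^+ n = 1 := prim_expr_order z_prim.

(** Translating b by a basis vector e_i with w_i <> 0 permutes the terms of the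
sum and multiplies it by z ^+ w_i, which differs from 1. *)
Lemma sum_characters w : w != 0 -> \sum_b z ^+ dot b w = 0.
Proof.
move=> w_neq0; have [i wi_neq0] : exists i, w 0 i != 0.
  apply/existsP; apply: contraNT w_neq0; rewrite negb_exists => /forallP w0.
  by apply/eqP/rowP => i; rewrite mxE; apply/eqP; apply: negbNE (w0 i).
have shift : \sum_b z ^+ dot b w = z ^+ (w 0 i) * \sum_b z ^+ dot b w.
  rewrite {1}(reindex_inj (addrI (delta_mx 0 i))) mulr_sumr /=.
  by apply: eq_bigr => b _; rewrite dotC dotDr dot_delta expr_ZpD // dotC.
have z_neq1 : z ^+ (w 0 i) != 1.
  rewrite -(prim_order_dvd z_prim) /dvdn modn_small //.
  by have := ltn_ord (w 0 i); rewrite [X in (_ < X)%N -> _]Zp_cast.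
move/eqP: shift; rewrite -subr_eq0 -{1}[\sum_b _]mul1r -mulrBl mulf_eq0.
by rewrite subr_eq0 eq_sym (negPf z_neq1) => /eqP.
Qed.

(** Fourier inversion: summing the transform of g against the characters at - y
leaves n^d * g y by orthogonality, so a function with vanishing transform
vanishes. *)
Lemma fourier_neq0 (g : 'rV['Z_n]_d -> F) y :
  g y != 0 -> exists b, \sum_x g x * z ^+ dot b x != 0.
Proof.
move=> gy_neq0; apply/existsP; apply: contraNT gy_neq0.
rewrite negb_exists => /forallP hat0.
have : \sum_b (\sum_x g x * z ^+ dot b x) * z ^+ dot b (- y) = 0.
  by rewrite big1 // => b _; rewrite (eqP (negbNE (hat0 b))) mul0r.
rewrite (eq_bigr (fun b => \sum_x g x * z ^+ dot b (x - y))); last first.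
  move=> b _; rewrite mulr_suml; apply: eq_bigr => x _.
  by rewrite dotDr expr_ZpD // mulrA.
rewrite exchange_big (bigD1 y) //= [X in _ + X]big1 => [|x ne_xy]; last first.
  by rewrite -mulr_sumr sum_characters ?mulr0 // subr_eq0.
rewrite addr0 -mulr_sumr subrr (eq_bigr (fun=> 1)) => [|b _]; last first.
  by rewrite /dot big1 // => i _; rewrite mxE mulr0.
rewrite sumr_const => /eqP; rewrite mulf_eq0 pnatr_eq0 => /orP[] //.
by rewrite -leqn0 leqNgt; case/negP; apply/card_gt0P; exists 0.
Qed.

(** The adjacency operator is convolution with the indicator of S, so the Fourier
transform turns it into multiplication by the character sums of S. At a point b
where the transform of an eigenvector does not vanish, the eigenvalue must equal
the character sum at b. *)
Lemma cayley_eigenvalue (e : rel 'rV['Z_n]_d) (S : {set 'rV['Z_n]_d}) a :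
    (forall x y, e x y = (y - x \in S)) ->
    eigenvalue (adjacency_mx F e) a ->
  exists b, a = \sum_(s in S) z ^+ dot b s.
Proof.
move=> eE /eigenvalueP[v vA v_neq0]; pose g x := v 0 (enum_rank x).
have gE y : a * g y = \sum_x g x * (e x y)%:R.
  have /rowP/(_ (enum_rank y)) := vA; rewrite !mxE => <-.
  rewrite (reindex enum_rank) /=; last exact/onW_bij/enum_rank_bij.
  by apply: eq_bigr => x _; rewrite mxE !enum_rankK.
have [y gy_neq0] : exists y, g y != 0.
  apply/existsP; apply: contraNT v_neq0; rewrite negb_exists => /forallP g0.
  apply/eqP/rowP => i; rewrite mxE -(enum_valK i); apply/eqP.
  exact: negbNE (g0 (enum_val i)).
have [b hat_neq0] := fourier_neq0 gy_neq0; exists b.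
apply: (mulIf hat_neq0); rewrite mulr_sumr.
under eq_bigr do rewrite mulrA gE mulr_suml.
rewrite exchange_big mulr_sumr; apply: eq_bigr => x _ /=.
rewrite (reindex_inj (addrI x)) /= [in RHS]big_mkcond mulr_suml /=.
apply: eq_bigr => s _; rewrite eE addrC addKr dotDr expr_ZpD //.
case: (s \in S); rewrite ?mulr1 ?mulr0 ?mul0r //.
by rewrite mulrA mulrC.
Qed.

End Fourier.

End Characters.

Theorem theorem3p6 (C : numClosedFieldType) (n d : nat)
    (n_gt1 : (1 < n)%N) (d_gt0 : (0 < d)%N) (n_odd_or_d_even : odd n || ~~ odd d)
    (a : C) :
  eigenvalue (adjacency_mx C (@unitary_euclidean n d)) a ->
  exists m : int, a = m%:~R.
Proof.
have [|z z_prim] := @closed_field_prim_root C n.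
  by rewrite pnatr_eq0 -lt0n ltnW.
pose S := [set x : 'rV['Z_n]_d | \sum_i x 0 i ^+ 2 \is a GRing.unit].
have eE x y : unitary_euclidean x y = (y - x \in S).
  rewrite unitary_euclidean_sym inE /unitary_euclidean.
  by under [in RHS]eq_bigr do rewrite !mxE.
move=> /(cayley_eigenvalue n_gt1 z_prim eE)[b ->].
apply: sum_free_unit_stable_integer => // [|x|x]; rewrite ?inE.
- exact: prim_expr_order.
- move=> x_unit u u_unit; rewrite inE.
  under eq_bigr do rewrite mxE exprMn.
  by rewrite -mulr_sumr unitrMl ?unitrX.
(* u *: x = v *: x gives u * q(x) = v * q(x), with q(x) invertible. *)
move=> x_unit u v uv; apply: (mulIr x_unit); rewrite !mulr_sumr.
apply: eq_bigr => i _; have /rowP/(_ i) := uv; rewrite !mxE => uvi.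
by rewrite expr2 !mulrA uvi.
Qed.
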